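(* Let $G\le\mathrm{O}(d)$ be finite and suppose $n>\chi(G)\cdot(d-1)$. Then for generic $(z_1,\ldots,z_n)\in(\mathbb{R}^d)^n$, the max filter bank $\Phi:\mathbb{R}^d/G\to\mathbb{R}^n$, $\Phi([x])=(\langle\!\langle[z_i],[x]\rangle\!\rangle)_{i=1}^n$, is bilipschitz, i.e. there exist $0<a\le b<\infty$ with $a\,d([x],[y])\le\|\Phi([x])-\Phi([y])\|\le b\,d([x],[y])$ for all $x,y\in\mathbb{R}^d$.
   Context: For $x\in\mathbb{R}^d$, $[x]:=\{gx:g\in G\}$; $d([x],[y]):=\min_{p\in[x],q\in[y]}\|p-q\|$; $\langle\!\langle[x],[y]\rangle\!\rangle:=\max_{p\in[x],q\in[y]}\langle p,q\rangle$. The open Voronoi cell $V_x$ is the set of $y$ such that $x$ is the unique maximizer of $\langle p,y\rangle$ over $p\in[x]$. $P(G):=\{x:\mathrm{stab}_G(x)=\{\mathrm{id}\}\}$, $S(x,y):=\{q\in[y]:V_q\cap V_x\ne\varnothing\}$, and the Voronoi characteristic is $\chi(G):=\max_{x,y\in P(G)}|S(x,y)|$. ''Generic'' means the property holds for all tuples outside a proper algebraic (hence Lebesgue-null, lower-dimensional) subset of $(\mathbb{R}^d)^n$. *)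

(* Defs.v *)
From HB Require Import structures.
From mathcomp Require Import all_boot all_order all_algebra.
From mathcomp Require Import mpoly.
From mathcomp Require Import reals.

Set Implicit Arguments.
Unset Strict Implicit.
Unset Printing Implicit Defensive.

Import Order.TTheory GRing.Theory Num.Theory.
Local Open Scope ring_scope.

Definition ip (R : realType) (m : nat) (p q : 'rV[R]_m) : R :=
  \sum_(i < m) p 0 i * q 0 i.
Definition enorm (R : realType) (m : nat) (p : 'rV[R]_m) : R :=
  Num.sqrt (ip p p).

Section MaxFilter.
Variables (R : realType) (d : nat).

(* G is a finite subgroup of O(d): a finite list of orthogonal matrices
   containing the identity and closed under multiplication (finiteness then
   gives closure under inverses). *)
Definition orthogonal_mx (g : 'M[R]_d) : Prop := g *m g^T = 1%:M.
Definition finite_subgroup_O (G : seq 'M[R]_d) : Prop :=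
  [/\ 1%:M \in G,
      (forall g h, g \in G -> h \in G -> g *m h \in G)
    & (forall g, g \in G -> orthogonal_mx g)].

(* action of g on x: the vector g x (x viewed as a column) *)
Definition act (g : 'M[R]_d) (x : 'rV[R]_d) : 'rV[R]_d := x *m g^T.

Definition orbit (G : seq 'M[R]_d) (x : 'rV[R]_d) : seq 'rV[R]_d :=
  [seq act g x | g <- G].

(* d([x],[y]) = min_{p in [x], q in [y]} ||p - q||.  The start value
   ||x - y|| is attained (1 \in G), so this is the true minimum. *)
Definition orbit_dist (G : seq 'M[R]_d) (x y : 'rV[R]_d) : R :=
  \big[Num.min/enorm (x - y)]_(p <- orbit G x)
     \big[Num.min/enorm (x - y)]_(q <- orbit G y) enorm (p - q).

Definition orbit_ip (G : seq 'M[R]_d) (x y : 'rV[R]_d) : R :=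
  \big[Num.max/ip x y]_(p <- orbit G x)
     \big[Num.max/ip x y]_(q <- orbit G y) ip p q.

Definition in_voronoi (G : seq 'M[R]_d) (x y : 'rV[R]_d) : Prop :=
  forall p, p \in orbit G x -> p != x -> ip p y < ip x y.

Definition principal (G : seq 'M[R]_d) (x : 'rV[R]_d) : Prop :=
  forall g, g \in G -> act g x = x -> g = 1%:M.

Definition card_S (G : seq 'M[R]_d) (x y : 'rV[R]_d) (k : nat) : Prop :=
  exists s : seq 'rV[R]_d,
    [/\ uniq s, size s = k &
        forall q, q \in s <->
          (q \in orbit G y /\ exists w, in_voronoi G q w /\ in_voronoi G x w)].

Definition voronoi_char (G : seq 'M[R]_d) (k : nat) : Prop :=
  (exists x y, [/\ principal G x, principal G y & card_S G x y k]) /\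
  (forall x y m, principal G x -> principal G y -> card_S G x y m -> (m <= k)%N).

Definition max_filter (G : seq 'M[R]_d) (n : nat) (Z : 'M[R]_(n, d))
    (x : 'rV[R]_d) : 'rV[R]_n :=
  \row_(i < n) orbit_ip G (row i Z) x.

Definition bilipschitz_mf (G : seq 'M[R]_d) (n : nat) (Z : 'M[R]_(n, d)) : Prop :=
  exists a b : R, [/\ 0 < a, a <= b &
    forall x y : 'rV[R]_d,
      a * orbit_dist G x y <= enorm (max_filter G Z x - max_filter G Z y)
      /\ enorm (max_filter G Z x - max_filter G Z y) <= b * orbit_dist G x y].

End MaxFilter.

(* Main.v *)
Require Import Defs.
From HB Require Import structures.
From mathcomp Require Import all_boot all_order all_algebra.
From mathcomp Require Import mpoly.
From mathcomp Require Import reals.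
From mathcomp Require boolp.
From mathcomp Require Import ring lra.

Import Order.TTheory GRing.Theory Num.Theory.
Local Open Scope ring_scope.

(** The maximum <<[z],[x]>> is attained as <z, g x>.  If each template z_i has
    unique maximizers g_i x and h_i y, then the i-th difference of filter values
    is <w_i, x - q_i> with w_i = g_i^-1 z_i and q_i = g_i^-1 h_i y, and w_i lies
    in both V_x and V_(q_i).  Hence the q_i take at most chi values, and since
    n > chi (d - 1) some value q is taken by d indices.  For generic templates
    any d of the translates of distinct z_i form a basis, and there are finitely
    many choices of translates, so |Phi x - Phi y| >= a |x - q| with a
    independent of x and y.  If all z_i are principal, the pairs (x, y) with
    unique maximizers are dense, and the bound passes to all pairs because both
    sides are Lipschitz. *)

(** * Euclidean geometry of row vectors *)

Lemma ipC {R : realType} {m : nat} (u v : 'rV[R]_m) : ip u v = ip v u.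
Proof. by apply: eq_bigr => i _; rewrite mulrC. Qed.

Lemma ipDr {R : realType} {m : nat} (u v w : 'rV[R]_m) :
  ip u (v + w) = ip u v + ip u w.
Proof. by rewrite -big_split; apply: eq_bigr => i _; rewrite mxE mulrDr. Qed.

Lemma ipZr {R : realType} {m : nat} (c : R) (u v : 'rV[R]_m) :
  ip u (c *: v) = c * ip u v.
Proof. by rewrite mulr_sumr; apply: eq_bigr => i _; rewrite mxE mulrCA. Qed.

Lemma ipNr {R : realType} {m : nat} (u v : 'rV[R]_m) : ip u (- v) = - ip u v.
Proof. by rewrite -scaleN1r ipZr mulN1r. Qed.

Lemma ipBr {R : realType} {m : nat} (u v w : 'rV[R]_m) :
  ip u (v - w) = ip u v - ip u w.
Proof. by rewrite ipDr ipNr. Qed.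

Lemma ipDl {R : realType} {m : nat} (u v w : 'rV[R]_m) :
  ip (u + v) w = ip u w + ip v w.
Proof. by rewrite ipC ipDr !(ipC w). Qed.

Lemma ipZl {R : realType} {m : nat} (c : R) (u v : 'rV[R]_m) :
  ip (c *: u) v = c * ip u v.
Proof. by rewrite ipC ipZr ipC. Qed.

Lemma ipNl {R : realType} {m : nat} (u v : 'rV[R]_m) : ip (- u) v = - ip u v.
Proof. by rewrite ipC ipNr ipC. Qed.

Lemma ip_ge0 {R : realType} {m : nat} (u : 'rV[R]_m) : 0 <= ip u u.
Proof. by apply: sumr_ge0 => i _; rewrite -expr2 sqr_ge0. Qed.

Lemma ip_eq0 {R : realType} {m : nat} (u : 'rV[R]_m) :
  (ip u u == 0) = (u == 0).
Proof.
apply/eqP/eqP => [u0|->]; last by rewrite /ip big1 // => i _; rewrite mxE mul0r.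
apply/rowP => i; rewrite mxE; apply/eqP; rewrite -sqrf_eq0 expr2.
by apply/eqP; apply: (psumr_eq0P _ u0) => // j _; rewrite -expr2 sqr_ge0.
Qed.

Lemma ip_mulmx {R : realType} {m k : nat} (u : 'rV[R]_m) (A : 'M[R]_(k, m))
    (v : 'rV[R]_k) :
  ip u (v *m A) = ip (u *m A^T) v.
Proof.
have ipE j (a b : 'rV[R]_j) : ip a b = (a *m b^T) 0 0.
  by rewrite mxE; apply: eq_bigr => i _; rewrite mxE.
by rewrite !ipE trmx_mul mulmxA.
Qed.

Lemma enorm_ge0 {R : realType} {m : nat} (u : 'rV[R]_m) : 0 <= enorm u.
Proof. exact: sqrtr_ge0. Qed.

Lemma enorm_sqr {R : realType} {m : nat} (u : 'rV[R]_m) : enorm u ^+ 2 = ip u u.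
Proof. by rewrite sqr_sqrtr // ip_ge0. Qed.

Lemma enormN {R : realType} {m : nat} (u : 'rV[R]_m) : enorm (- u) = enorm u.
Proof. by rewrite /enorm ipNl ipNr opprK. Qed.

Lemma enormB {R : realType} {m : nat} (u v : 'rV[R]_m) :
  enorm (u - v) = enorm (v - u).
Proof. by rewrite -enormN opprB. Qed.

Lemma enormZ {R : realType} {m : nat} (c : R) (u : 'rV[R]_m) :
  enorm (c *: u) = `|c| * enorm u.
Proof. by rewrite /enorm ipZl ipZr mulrA -expr2 sqrtrM ?sqr_ge0 // sqrtr_sqr. Qed.

Lemma Cauchy_Schwarz_ip {R : realType} {m : nat} (u v : 'rV[R]_m) :
  ip u v ^+ 2 <= ip u u * ip v v.
Proof.
have [/eqP|v0] := eqVneq (ip v v) 0.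
  rewrite ip_eq0 => /eqP ->; rewrite -(scale0r v) !ipZr !ipZl.
  by rewrite !mul0r mulr0 expr0n.
have vv : 0 < ip v v by rewrite lt_def v0 ip_ge0.
(* Expanding this squared norm gives [ip v v] times the gap in the inequality. *)
have := ip_ge0 (ip v v *: u - ip u v *: v).
rewrite ipBr !ipZr !ipDl !ipNl !ipZl (ipC v u).
set a := ip v v in vv *; set b := ip u v; set c := ip u u => H.
have : 0 <= a * (c * a - b ^+ 2) by move: H; congr (_ <= _); ring.
by rewrite pmulr_rge0 // subr_ge0.
Qed.

Lemma ip_le_enorm {R : realType} {m : nat} (u v : 'rV[R]_m) :
  ip u v <= enorm u * enorm v.
Proof.
apply: le_trans (ler_norm _) _.
rewrite -(@ler_pXn2r _ 2) ?nnegrE ?mulr_ge0 ?enorm_ge0 ?normr_ge0 //.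
by rewrite exprMn !enorm_sqr real_normK ?num_real // Cauchy_Schwarz_ip.
Qed.

Lemma enormD {R : realType} {m : nat} (u v : 'rV[R]_m) :
  enorm (u + v) <= enorm u + enorm v.
Proof.
rewrite -(@ler_pXn2r _ 2) ?nnegrE ?addr_ge0 ?enorm_ge0 //.
rewrite sqrrD !enorm_sqr ipDr !ipDl (ipC v u).
by have := ip_le_enorm u v; lra.
Qed.

(** Cauchy-Schwarz in each output coordinate bounds the squared norm through the squared Frobenius
    norm [S]. The constant [S + 1] is positive and its square dominates [S], which avoids a square
    root. *)
Lemma enorm_mulmx_bounded {R : realType} {m k : nat} (A : 'M[R]_(m, k)) :
  exists2 C : R, 0 < C & forall u : 'rV[R]_m, enorm (u *m A) <= C * enorm u.
Proof.
pose S := \sum_(j < k) ip (row j A^T) (row j A^T).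
have S0 : 0 <= S by apply: sumr_ge0 => j _; apply: ip_ge0.
exists (S + 1) => [|u]; first lra.
rewrite -(@ler_pXn2r _ 2) ?nnegrE ?mulr_ge0 ?enorm_ge0 //; last lra.
rewrite exprMn !enorm_sqr.
apply: (@le_trans _ _ (S * ip u u)); last first.
  by apply: ler_wpM2r; rewrite ?ip_ge0 //; nra.
rewrite {1}/ip mulr_suml; apply: ler_sum => j _; rewrite -expr2.
apply: le_trans (Cauchy_Schwarz_ip _ _); rewrite ipC.
by rewrite le_eqVlt; apply/orP; left; apply/eqP; congr (_ ^+ 2);
  rewrite mxE; apply: eq_bigr => l _; rewrite !mxE.
Qed.

(** Since [u] is recovered from [u *m A] by the inverse, an upper bound for [invmx A] yields a lower
    bound for [A]. *)
Lemma enorm_unitmx_lower {R : realType} {m : nat} (A : 'M[R]_m) :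
  A \in unitmx ->
  exists2 a : R, 0 < a & forall u : 'rV[R]_m, a * enorm u <= enorm (u *m A).
Proof.
move=> uA; have [C C0 hC] := enorm_mulmx_bounded (invmx A).
exists C^-1 => [|u]; first by rewrite invr_gt0.
by rewrite mulrC ler_pdivrMr // mulrC -{1}(mulmxK uA u) hC.
Qed.

Lemma exists_small_notin {R : realType} (B : seq R) (e : R) : 0 < e ->
  exists t, [/\ 0 < t, t <= e & t \notin B].
Proof.
elim: B e => [|b B IH] e e0; first by exists e.
have [b0|b0] := leP b 0.
  have [t [t0 te tB]] := IH _ e0.
  by exists t; split; rewrite // inE negb_or tB gt_eqF // (le_lt_trans b0).
have m0 : 0 < Num.min e (b / 2) by rewrite lt_min e0 /=; lra.
have [t [t0 te tB]] := IH _ m0; move: te; rewrite le_min => /andP[te tb].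
by exists t; split; rewrite // inE negb_or tB lt_eqF //; lra.
Qed.

(** Push the point off the hyperplane of [u] by a small multiple of [u]. Each other condition is
    either unaffected or excludes a single size of the push. *)
Lemma avoid_hyperplanes_dense {R : realType} {m : nat} (s : seq 'rV[R]_m)
    (x : 'rV[R]_m) (e : R) :
  0 < e -> 0 \notin s ->
  exists2 x', enorm (x - x') <= e & forall u, u \in s -> ip u x' != 0.
Proof.
elim: s x e => [|u s IH] x e e0.
  exists x => //; suff -> : enorm (x - x) = 0 by apply: ltW.
  by rewrite subrr; apply/eqP; rewrite -sqrf_eq0 enorm_sqr ip_eq0.
rewrite inE negb_or eq_sym => /andP[u0 s0].
have [|x' xx' x's] := IH x (e / 2) _ s0; first lra.
have c0 : 0 < enorm u + 1 by rewrite ltr_wpDl ?enorm_ge0.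
have e'0 : 0 < e / 2 / (enorm u + 1) by rewrite divr_gt0 //; lra.
(* The list holds the roots in [t] of [ip v (x' + t *: u)]. When [ip v u] vanishes the quotient is
   0, which excludes nothing since [t] is positive. *)
have [t [t0 te tB]] := exists_small_notin
  [seq - ip v x' / ip v u | v <- u :: s] _ e'0.
exists (x' + t *: u) => [|v vs].
  have -> : x - (x' + t *: u) = (x - x') + (- t) *: u.
    by rewrite scaleNr opprD addrA.
  apply: le_trans (enormD _ _) _; rewrite enormZ normrN gtr0_norm //.
  move: te; rewrite ler_pdivlMr // => te.
  by have := enorm_ge0 u; lra.
rewrite ipDr ipZr; apply/eqP => h0.
have [vu|vu] := eqVneq (ip v u) 0.
  move: vs; rewrite inE => /orP[/eqP vE|vs].
    by move/eqP: vu; rewrite vE ip_eq0 (negbTE u0).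
  by move: h0; rewrite vu mulr0 addr0; apply/eqP/x's.
move/negP: tB; apply; apply/mapP; exists v => //.
by apply: (mulIf vu); rewrite divfK //; lra.
Qed.

(** * Finite orthogonal groups and their orbits *)

Lemma act_mul {R : realType} {d : nat} (g h : 'M[R]_d) (x : 'rV[R]_d) :
  act g (act h x) = act (g *m h) x.
Proof. by rewrite /act trmx_mul mulmxA. Qed.

Lemma act1 {R : realType} {d : nat} (x : 'rV[R]_d) : act 1%:M x = x.
Proof. by rewrite /act trmx1 mulmx1. Qed.

Lemma actB {R : realType} {d : nat} (g : 'M[R]_d) (x y : 'rV[R]_d) :
  act g (x - y) = act g x - act g y.
Proof. by rewrite /act mulmxBl. Qed.

Lemma ip_act {R : realType} {d : nat} (g : 'M[R]_d) (x y : 'rV[R]_d) :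
  ip x (act g y) = ip (act g^T x) y.
Proof. by rewrite /act ip_mulmx. Qed.

Lemma mulTmx_orthogonal {R : realType} {d : nat} (g : 'M[R]_d) :
  orthogonal_mx g -> g^T *m g = 1%:M.
Proof. exact: mulmx1C. Qed.

Lemma enorm_act {R : realType} {d : nat} (g : 'M[R]_d) (x : 'rV[R]_d) :
  orthogonal_mx g -> enorm (act g x) = enorm x.
Proof.
by move=> og; rewrite /enorm ip_act act_mul mulTmx_orthogonal // act1.
Qed.

(* Left multiplication by g is injective on the finite set G, hence onto. *)
Lemma trmx_in_group {R : realType} {d : nat} (G : seq 'M[R]_d) (g : 'M[R]_d) :
  finite_subgroup_O G -> g \in G -> g^T \in G.
Proof.
move=> [G1 GM GO] gG; have og := mulTmx_orthogonal _ (GO _ gG).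
have inj : injective (mulmx g : 'M[R]_d -> 'M[R]_d).
  by move=> a b /(congr1 (mulmx g^T)); rewrite !mulmxA og !mul1mx.
have [|||_ eqG] := @uniq_min_size _ [seq g *m h | h <- undup G] (undup G).
- by rewrite map_inj_uniq ?undup_uniq.
- move=> _ /mapP[h hG ->]; rewrite mem_undup in hG.
  by rewrite mem_undup GM.
- by rewrite size_map.
have : 1%:M \in undup G by rewrite mem_undup.
rewrite -eqG => /mapP[h]; rewrite mem_undup => hG /(congr1 (mulmx g^T)).
by rewrite mulmx1 mulmxA og mul1mx => ->.
Qed.

(** The default [c] is harmless once some term reaches it: a maximum equal to [c] is then also the
    value of that term. *)
Lemma bigmax_seq_attained {R : realType} {T : eqType} (F : T -> R) (c : R)
    (s : seq T) :
  (exists2 t, t \in s & c <= F t) ->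
  exists2 t, t \in s & \big[Num.max/c]_(i <- s) F i = F t.
Proof.
case=> t0 t0s ct0.
have H : (\big[Num.max/c]_(i <- s) F i = c) \/
    exists2 t, t \in s & \big[Num.max/c]_(i <- s) F i = F t.
  elim: s {t0s} => [|a s IH]; first by left; rewrite big_nil.
  rewrite big_cons maxEle; case: ifP => _; last first.
    by right; exists a; rewrite ?mem_head.
  case: IH => [->|[t ts ->]]; first by left.
  by right; exists t; rewrite // inE ts orbT.
case: H => // Hc; exists t0 => //.
by apply/eqP; rewrite eq_le le_bigmax_seq // Hc ct0.
Qed.

Lemma bigmin_seq_opp {R : realType} {T : eqType} (F : T -> R) (c : R)
    (s : seq T) :
  \big[Num.min/c]_(i <- s) F i = - \big[Num.max/- c]_(i <- s) - F i.
Proof.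
elim: s => [|a s IH]; first by rewrite !big_nil opprK.
by rewrite !big_cons IH oppr_max !opprK.
Qed.

Lemma orbit_ip_ge {R : realType} {d : nat} (G : seq 'M[R]_d)
    (z x : 'rV[R]_d) (g : 'M[R]_d) :
  finite_subgroup_O G -> g \in G -> ip z (act g x) <= orbit_ip G z x.
Proof.
move=> [G1 _ _] gG.
have zO : z \in Defs.orbit G z by apply/mapP; exists 1%:M; rewrite ?act1.
have gxO : act g x \in Defs.orbit G x by apply/mapP; exists g.
apply: le_trans (le_bigmax_seq _ _ _ _ zO isT).
exact: le_bigmax_seq.
Qed.

(** By orthogonality [<g z, h x>] equals [<z, g^T h x>], so one group element does the work of
    two. *)
Lemma orbit_ip_attained {R : realType} {d : nat} (G : seq 'M[R]_d)
    (z x : 'rV[R]_d) :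
  finite_subgroup_O G ->
  exists2 g, g \in G & orbit_ip G z x = ip z (act g x).
Proof.
move=> GG; have [G1 GM GO] := GG.
have mO w : w \in Defs.orbit G w by apply/mapP; exists 1%:M; rewrite ?act1.
rewrite /orbit_ip.
have [|_ /mapP[g gG ->] ->] := bigmax_seq_attained
  (fun p => \big[Num.max/ip z x]_(q <- Defs.orbit G x) ip p q) (ip z x) (Defs.orbit G z).
  exists z => //; exact: le_bigmax_seq.
have [|_ /mapP[h hG ->] hE] := bigmax_seq_attained
  (ip (act g z)) (ip z x) (Defs.orbit G x).
  (* The default [ip z x] is the term at [act g x], as [g] preserves inner products. *)
  exists (act g x); first by apply/mapP; exists g.
  by rewrite ip_act act_mul mulTmx_orthogonal ?act1 //; apply: GO.
rewrite /= hE; exists (g^T *m h); first by rewrite GM // trmx_in_group.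
by rewrite -act_mul [RHS]ip_act trmxK.
Qed.

Lemma orbit_dist_le {R : realType} {d : nat} (G : seq 'M[R]_d)
    (x y : 'rV[R]_d) (h : 'M[R]_d) :
  finite_subgroup_O G -> h \in G -> orbit_dist G x y <= enorm (x - act h y).
Proof.
move=> [G1 _ _] hG.
have xO : x \in Defs.orbit G x by apply/mapP; exists 1%:M; rewrite ?act1.
have hyO : act h y \in Defs.orbit G y by apply/mapP; exists h.
apply: le_trans (ge_bigmin_seq _ _ _ _ xO isT) _.
exact: (ge_bigmin_seq _ _ _ _ hyO).
Qed.

Lemma orbit_dist_attained {R : realType} {d : nat} (G : seq 'M[R]_d)
    (x y : 'rV[R]_d) :
  finite_subgroup_O G ->
  exists2 h, h \in G & orbit_dist G x y = enorm (x - act h y).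
Proof.
move=> GG; have [G1 GM GO] := GG.
have mO w : w \in Defs.orbit G w by apply/mapP; exists 1%:M; rewrite ?act1.
rewrite /orbit_dist bigmin_seq_opp.
have [|_ /mapP[g gG ->] ->] := bigmax_seq_attained
  (fun p => - \big[Num.min/enorm (x - y)]_(q <- Defs.orbit G y) enorm (p - q))
  (- enorm (x - y)) (Defs.orbit G x).
  by exists x; rewrite // lerN2; apply: ge_bigmin_seq.
rewrite opprK bigmin_seq_opp.
have [|_ /mapP[h hG ->] ->] := bigmax_seq_attained
  (fun q => - enorm (act g x - q)) (- enorm (x - y)) (Defs.orbit G y).
  exists (act g y); first by apply/mapP; exists g.
  by rewrite -actB enorm_act //; apply: GO.
exists (g^T *m h); first by rewrite GM // trmx_in_group.
rewrite opprK -[RHS](enorm_act _ _ (GO _ gG)) actB act_mul mulmxA.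
by rewrite (GO _ gG) mul1mx.
Qed.

(** An [h] optimal for [x'] and [y'] is a competitor for [x] and [y]. The density argument needs
    this Lipschitz property. *)
Lemma orbit_dist_triangle {R : realType} {d : nat} (G : seq 'M[R]_d)
    (x y x' y' : 'rV[R]_d) :
  finite_subgroup_O G ->
  orbit_dist G x y <= orbit_dist G x' y' + enorm (x - x') + enorm (y - y').
Proof.
move=> GG; have [_ _ GO] := GG.
have [h hG ->] := orbit_dist_attained _ x' y' GG.
apply: le_trans (orbit_dist_le _ x y _ GG hG) _.
have -> : x - act h y = (x' - act h y') + (x - x') + act h (y' - y).
  rewrite actB; move: (act h y) (act h y') => u v.
  by apply/rowP => i; rewrite !mxE; ring.
apply: le_trans (enormD _ _) _; rewrite enorm_act; last exact: GO.
by rewrite (enormB y) lerD2r enormD.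
Qed.

Lemma orbit_ip_act {R : realType} {d : nat} (G : seq 'M[R]_d)
    (z x : 'rV[R]_d) (h : 'M[R]_d) :
  finite_subgroup_O G -> h \in G -> orbit_ip G z (act h x) = orbit_ip G z x.
Proof.
move=> GG hG; have [_ GM GO] := GG; apply/eqP; rewrite eq_le; apply/andP; split.
  have [g gG ->] := orbit_ip_attained _ z (act h x) GG.
  by rewrite act_mul orbit_ip_ge ?GM.
have [k kG ->] := orbit_ip_attained _ z x GG.
have kh : k *m h^T \in G by rewrite GM // trmx_in_group.
have := orbit_ip_ge _ z (act h x) _ GG kh.
by rewrite act_mul -mulmxA mulTmx_orthogonal ?mulmx1 //; apply: GO.
Qed.

Lemma max_filter_act {R : realType} {d n : nat} (G : seq 'M[R]_d)
    (Z : 'M[R]_(n, d)) (x : 'rV[R]_d) (h : 'M[R]_d) :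
  finite_subgroup_O G -> h \in G ->
  max_filter G Z (act h x) = max_filter G Z x.
Proof. by move=> GG hG; apply/rowP => i; rewrite !mxE orbit_ip_act. Qed.

(** The maximizer for [x] serves as a competitor for [y]; being orthogonal, it then drops out of the
    norm. *)
Lemma orbit_ip_subr_le {R : realType} {d : nat} (G : seq 'M[R]_d)
    (z x y : 'rV[R]_d) :
  finite_subgroup_O G ->
  orbit_ip G z x - orbit_ip G z y <= enorm z * enorm (x - y).
Proof.
move=> GG; have [_ _ GO] := GG.
have [g gG ->] := orbit_ip_attained _ z x GG.
apply: (@le_trans _ _ (ip z (act g x) - ip z (act g y))).
  by rewrite lerD2l lerN2 orbit_ip_ge.
rewrite -ipBr -actB -(enorm_act g (x - y)); last exact: GO.
exact: ip_le_enorm.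
Qed.

(** Sum the squares of the coordinate bounds. Invariance of the filter later turns [enorm (x - y)]
    into the orbit distance. *)
Lemma max_filter_Lipschitz {R : realType} {d n : nat} (G : seq 'M[R]_d)
    (Z : 'M[R]_(n, d)) :
  finite_subgroup_O G ->
  exists2 b : R, 0 < b & forall x y : 'rV[R]_d,
    enorm (max_filter G Z x - max_filter G Z y) <= b * enorm (x - y).
Proof.
move=> GG; pose S := \sum_(i < n) enorm (row i Z) ^+ 2.
have S0 : 0 <= S by apply: sumr_ge0 => i _; apply: sqr_ge0.
exists (S + 1) => [|x y]; first lra.
rewrite -(@ler_pXn2r _ 2) ?nnegrE ?mulr_ge0 ?enorm_ge0 //; last lra.
rewrite exprMn !enorm_sqr.
apply: (@le_trans _ _ (S * ip (x - y) (x - y))); last first.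
  by apply: ler_wpM2r; rewrite ?ip_ge0 //; nra.
rewrite {1}/ip mulr_suml; apply: ler_sum => i _; rewrite -expr2 !mxE.
rewrite -enorm_sqr -exprMn -real_normK ?num_real //.
rewrite ler_pXn2r ?nnegrE ?mulr_ge0 ?enorm_ge0 ?normr_ge0 //.
rewrite ler_norml orbit_ip_subr_le // andbT lerNl opprB enormB.
exact: orbit_ip_subr_le.
Qed.

(** * Generic properties of templates *)

Definition generic {R : realType} {n d : nat} (P : 'M[R]_(n, d) -> Prop) : Prop :=
  exists p : {mpoly R[n * d]}, p != 0 /\
    forall Z : 'M[R]_(n, d), p.@[fun k => mxvec Z 0 k] != 0 -> P Z.

Definition polynomial_fun {R : realType} {n d : nat} (F : 'M[R]_(n, d) -> R) : Prop :=
  exists p : {mpoly R[n * d]},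
    forall Z : 'M[R]_(n, d), p.@[fun k => mxvec Z 0 k] = F Z.

(** The product of the witnesses works: polynomials over a field form a domain, and a nonzero value
    of the product makes every factor nonzero there. *)
Lemma generic_all {R : realType} {n d : nat} {I : eqType} (s : seq I)
    (P : I -> 'M[R]_(n, d) -> Prop) :
  (forall i, i \in s -> generic (P i)) ->
  generic (fun Z => forall i, i \in s -> P i Z).
Proof.
elim: s => [|a s IH] H; first by exists 1; rewrite oner_eq0.
have [|p [p0 pP]] := IH; first by move=> i si; apply: H; rewrite inE si orbT.
have [q [q0 qP]] := H a (mem_head _ _).
exists (q * p); split; first by rewrite mulf_neq0.
move=> Z; rewrite mevalM mulf_eq0 negb_or => /andP[/qP Qa /pP Ps] i.
by rewrite inE => /orP[/eqP->|/Ps].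
Qed.

(** One tuple with a nonzero value already shows that the representing polynomial is not zero. *)
Lemma generic_neq0 {R : realType} {n d : nat} (F : 'M[R]_(n, d) -> R)
    (Z0 : 'M[R]_(n, d)) :
  polynomial_fun F -> F Z0 != 0 -> generic (fun Z => F Z != 0).
Proof.
move=> [p pE] F0; exists p; split=> [|Z]; last by rewrite pE.
by apply: contraNneq F0 => p0; rewrite -pE p0 meval0.
Qed.

Lemma polynomial_fun_ext {R : realType} {n d : nat} (F F' : 'M[R]_(n, d) -> R) :
  F =1 F' -> polynomial_fun F -> polynomial_fun F'.
Proof. by move=> FF' [p pE]; exists p => Z; rewrite pE FF'. Qed.

Lemma polynomial_fun_cst {R : realType} {n d : nat} (c : R) :
  polynomial_fun (fun _ : 'M[R]_(n, d) => c).
Proof. by exists c%:MP => Z; rewrite mevalC. Qed.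

Lemma polynomial_fun_entry {R : realType} {n d : nat} (i : 'I_n) (j : 'I_d) :
  polynomial_fun (fun Z : 'M[R]_(n, d) => Z i j).
Proof. by exists 'X_(mxvec_index i j) => Z; rewrite mevalXU mxvecE. Qed.

Lemma polynomial_funM {R : realType} {n d : nat} (F F' : 'M[R]_(n, d) -> R) :
  polynomial_fun F -> polynomial_fun F' ->
  polynomial_fun (fun Z => F Z * F' Z).
Proof. by move=> [p pE] [q qE]; exists (p * q) => Z; rewrite mevalM pE qE. Qed.

Lemma polynomial_fun_sum {R : realType} {n d : nat} {I : Type} (s : seq I)
    (F : I -> 'M[R]_(n, d) -> R) :
  (forall i, polynomial_fun (F i)) ->
  polynomial_fun (fun Z => \sum_(i <- s) F i Z).
Proof.
move=> H; elim: s => [|a s [p pE]].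
  by exists 0 => Z; rewrite big_nil meval0.
by have [q qE] := H a; exists (q + p) => Z; rewrite big_cons mevalD pE qE.
Qed.

Lemma polynomial_fun_prod {R : realType} {n d : nat} {I : Type} (s : seq I)
    (F : I -> 'M[R]_(n, d) -> R) :
  (forall i, polynomial_fun (F i)) ->
  polynomial_fun (fun Z => \prod_(i <- s) F i Z).
Proof.
move=> H; elim: s => [|a s [p pE]].
  by exists 1 => Z; rewrite big_nil meval1.
by have [q qE] := H a; exists (q * p) => Z; rewrite big_cons mevalM pE qE.
Qed.

Lemma polynomial_fun_det {R : realType} {n d m : nat}
    (M : 'M[R]_(n, d) -> 'M[R]_m) :
  (forall i j, polynomial_fun (fun Z => M Z i j)) ->
  polynomial_fun (fun Z => \det (M Z)).
Proof.
move=> H; apply: polynomial_fun_sum => s.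
by apply: polynomial_funM; [apply: polynomial_fun_cst|apply: polynomial_fun_prod].
Qed.

Lemma polynomial_fun_act {R : realType} {n d : nat} (g : 'M[R]_d) (i : 'I_n)
    (j : 'I_d) :
  polynomial_fun (fun Z : 'M[R]_(n, d) => act g (row i Z) 0 j).
Proof.
apply: (@polynomial_fun_ext _ _ _ (fun Z => \sum_k Z i k * g j k)).
  by move=> Z; rewrite mxE; apply: eq_bigr => k _; rewrite !mxE.
apply: polynomial_fun_sum => k.
by apply: polynomial_funM; [apply: polynomial_fun_entry|apply: polynomial_fun_cst].
Qed.

(** For each [g] other than the identity, some coordinate of [g z_i - z_i] is a nonzero linear form
    in [z_i]. *)
Lemma generic_principal {R : realType} {n d : nat} (G : seq 'M[R]_d) :
  generic (fun Z : 'M[R]_(n, d) => forall i, principal G (row i Z)).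
Proof.
have [p [p0 pP]] : generic (fun Z : 'M[R]_(n, d) =>
    forall ig, ig \in allpairs pair (enum 'I_n) G ->
      ig.2 != 1%:M -> act ig.2 (row ig.1 Z) != row ig.1 Z).
  apply: generic_all => -[i g] _ /=.
  have [->|g1] := eqVneq g 1%:M.
    by exists 1; rewrite oner_eq0.
  have [[j k] /= jk] : exists jk, g jk.1 jk.2 != 1%:M jk.1 jk.2.
    apply/existsP; rewrite -negb_forall; apply: contraNN g1 => /forallP H.
    by apply/eqP/matrixP => j k; apply/eqP/(H (j, k)).
  (* The test tuple has every template equal to the basis vector [e_k], where the form takes the
     value [g j k - 1%:M j k]. *)
  have [] := @generic_neq0 R n d
      (fun Z => act g (row i Z) 0 j + (-1) * Z i j)
      (\matrix_(a, b) (b == k)%:R).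
  - have [q qE] := @polynomial_fun_act R n d g i j.
    exists (q + (-1)%:MP * 'X_(mxvec_index i j)) => Z.
    by rewrite mevalD mevalM mevalC mevalXU mxvecE qE.
  - rewrite !mxE (bigD1 k) //= big1 ?addr0.
      rewrite !mxE eqxx mul1r mulN1r subr_eq0; apply: contraNneq jk => ->.
      by rewrite !mxE.
    by move=> l /negbTE lk; rewrite !mxE lk mul0r.
  move=> q [q0 qP]; exists q; split=> // Z /qP H _.
  apply: contraNneq H => ->.
  by rewrite mulN1r !mxE subrr.
exists p; split=> // Z /pP H i g gG gz; apply/eqP; apply: contraTT isT => g1.
have := H (i, g) _ g1; rewrite /= gz eqxx; apply.
by apply/allpairsP; exists (i, g); rewrite /= mem_enum.
Qed.

(** [f] selects [d] templates and [c] a translate of each. With [c] valued in the finite type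
    [seq_sub G], only finitely many matrices have to be controlled. *)
Definition template_mx {R : realType} {n d : nat} (G : seq 'M[R]_d)
    (f : 'I_d -> 'I_n) (c : 'I_d -> seq_sub G) (Z : 'M[R]_(n, d)) : 'M[R]_d :=
  \matrix_j act (ssval (c j)) (row (f j) Z).

Lemma generic_template_mx {R : realType} {n d : nat} (G : seq 'M[R]_d) :
  finite_subgroup_O G ->
  generic (fun Z : 'M[R]_(n, d) =>
    forall (f : {ffun 'I_d -> 'I_n}) (c : {ffun 'I_d -> seq_sub G}),
      injective f -> \det (template_mx G f c Z) != 0).
Proof.
move=> [_ _ GO].
have [p [p0 pP]] : generic (fun Z : 'M[R]_(n, d) =>
    forall fc, fc \in enum {: {ffun 'I_d -> 'I_n} * {ffun 'I_d -> seq_sub G}} ->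
      injectiveb fc.1 -> \det (template_mx G fc.1 fc.2 Z) != 0).
  apply: generic_all => -[f c] _ /=.
  have [/injectiveP injf|_] := boolP (injectiveb f); last first.
    by exists 1; rewrite oner_eq0.
  (* Row [f j] is the inverse of [c j] applied to [e_j], unambiguous for injective [f], so that
     translating by [c j] produces the identity matrix. Unselected rows are 0. *)
  pose Z0 : 'M[R]_(n, d) := \matrix_i
    if [pick j | f j == i] is Some j then row j 1%:M *m ssval (c j) else 0.
  have [] := @generic_neq0 R n d (fun Z => \det (template_mx G f c Z)) Z0.
  - apply: polynomial_fun_det => j k.
    apply: polynomial_fun_ext (polynomial_fun_act (ssval (c j)) (f j) k) => Z.
    by rewrite !mxE.
  - suff -> : template_mx G f c Z0 = 1%:M by rewrite det1 oner_eq0.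
    apply/row_matrixP => j; rewrite !rowK.
    case: pickP => [j' /eqP/injf ->|/(_ j)]; last by rewrite eqxx.
    by rewrite /act -mulmxA (GO _ (ssvalP (c j))) mulmx1.
  by move=> q [q0 qP]; exists q; split=> // Z /qP.
exists p; split=> // Z /pP H f c /injectiveP injf.
by apply: (H (f, c)); rewrite ?mem_enum.
Qed.

(** * The lower Lipschitz bound *)

Lemma exists_uniform_constant {R : realType} {I : finType} (P : I -> R -> Prop) :
  (forall i a b, 0 < b -> b <= a -> P i a -> P i b) ->
  (forall i, exists2 a, 0 < a & P i a) ->
  exists2 a, 0 < a & forall i, P i a.
Proof.
move=> mono /fin_all_exists2[a a0 aP].
(* The default 1 keeps the minimum positive even for an empty index type. *)
have m0 : 0 < \big[Num.min/1]_i a i by apply: lt_bigmin => // i _; apply: a0.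
by exists (\big[Num.min/1]_i a i) => // i; apply: mono (aP i); rewrite ?bigmin_le.
Qed.

Lemma pigeonhole_fiber {T : eqType} {n d : nat} (q : 'I_n -> T) (s : seq T) :
  (forall i, q i \in s) -> (size s * (d - 1) < n)%N ->
  exists2 q0, q0 \in s & exists2 f : {ffun 'I_d -> 'I_n}, injective f & forall j, q (f j) = q0.
Proof.
move=> qs sn.
have [/hasP[q0 q0s dq]|/hasPn H] :=
  boolP (has (fun t => (d <= #|[set i | q i == t]|)%N) s).
  exists q0 => //; exists [ffun j => enum_val (widen_ord dq j)] => [j k|j].
    by rewrite !ffunE => /enum_val_inj/(congr1 val)/= jk; apply: val_inj.
  by rewrite ffunE; have := enum_valP (widen_ord dq j); rewrite inE => /eqP.
move: sn; rewrite ltnNge => /negP[].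
have -> : n = (\sum_(i < n) 1)%N by rewrite sum1_card card_ord.
(* Double counting: every index [i] meets at least one [t] in [s], while every fibre has fewer than
   [d] elements. *)
apply: (@leq_trans (\sum_(t <- s) \sum_(i < n) (q i == t))%N).
  rewrite exchange_big; apply: leq_sum => i _.
  have -> : (\sum_(t <- s) (q i == t) = count_mem (q i) s)%N.
    rewrite -sum1_count [RHS]big_mkcond; apply: eq_bigr => t _.
    by rewrite eq_sym /=; case: eqP.
  by rewrite -has_count has_pred1.
rewrite -sum1_size big_distrl /= big_seq [leqRHS]big_seq; apply: leq_sum => t ts.
rewrite mul1n -big_mkcond sum1_card.
(* For [d = 0] a fibre of negative size is absurd; otherwise [d - 1] is the true predecessor. *)
have := H t ts; rewrite -ltnNge cardsE; case: d {H} => // d'.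
by rewrite subn1.
Qed.

(** Every template then has a unique maximizing group element. Asking for distinct values at all
    pairs turns this into avoiding finitely many hyperplanes. *)
Definition separated {R : realType} {n d : nat} (G : seq 'M[R]_d)
    (Z : 'M[R]_(n, d)) (x : 'rV[R]_d) : Prop :=
  forall i g h, g \in G -> h \in G -> g != h ->
    ip (row i Z) (act g x) != ip (row i Z) (act h x).

(** A nontrivial stabilizing [g] would tie with the identity at any template, and [0 < n] supplies
    one. *)
Lemma separated_principal {R : realType} {n d : nat} (G : seq 'M[R]_d)
    (Z : 'M[R]_(n, d)) (x : 'rV[R]_d) :
  finite_subgroup_O G -> (0 < n)%N -> separated G Z x -> principal G x.
Proof.
move=> [G1 _ _] n0 sx g gG gx; apply/eqP; apply: contraTT isT => g1.
by have := sx (Ordinal n0) g 1%:M gG G1 g1; rewrite act1 gx eqxx.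
Qed.

(** The hyperplanes to avoid have normals [g^T z_i - h^T z_i]. These are nonzero: otherwise [h g^T]
    would fix the principal point [z_i], forcing [g = h]. *)
Lemma separated_dense {R : realType} {n d : nat} (G : seq 'M[R]_d)
    (Z : 'M[R]_(n, d)) (x : 'rV[R]_d) (e : R) :
  finite_subgroup_O G -> (forall i, principal G (row i Z)) -> 0 < e ->
  exists2 x', enorm (x - x') <= e & separated G Z x'.
Proof.
move=> GG prZ e0; have [_ GM GO] := GG.
pose T := [seq t <- [seq (i, gh) | i <- enum 'I_n, gh <- [seq (g, h) | g <- G, h <- G]]
          | t.2.1 != t.2.2].
pose s := [seq act t.2.1^T (row t.1 Z) - act t.2.2^T (row t.1 Z) | t <- T].
have s0 : 0 \notin s.
  apply/negP => /mapP[[i [g h]]]; rewrite mem_filter => /andP[/= gh].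
  case/allpairsP=> -[_ _] [_ /= /allpairsP[[g' h'] [/= gG hG]] -> [_ gE hE]].
  rewrite -{}gE -{}hE in gG hG => /esym/eqP; rewrite subr_eq0 => /eqP.
  move/(congr1 (act h)); rewrite !act_mul (GO _ hG) act1 => /prZ hg.
  move/eqP: gh; apply.
  have := hg (GM _ _ hG (trmx_in_group _ _ GG gG)) => /(congr1 (mulmxr g)) /=.
  by rewrite -mulmxA mulTmx_orthogonal ?mulmx1 ?mul1mx //; apply: GO.
have [x' xx' sx'] := avoid_hyperplanes_dense _ x _ e0 s0.
exists x' => // i g h gG hG gh; rewrite !ip_act -subr_eq0 -ipNl -ipDl.
apply: sx'; apply/mapP; exists (i, (g, h)) => //.
rewrite mem_filter gh /=; apply/allpairsP; exists (i, (g, h)); split=> //=.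
  by rewrite mem_enum.
by apply/allpairsP; exists (g, h).
Qed.

Lemma separated_maximizer {R : realType} {n d : nat} (G : seq 'M[R]_d)
    (Z : 'M[R]_(n, d)) (x : 'rV[R]_d) (i : 'I_n) (g h : 'M[R]_d) :
  finite_subgroup_O G -> separated G Z x -> g \in G -> h \in G -> h != g ->
  orbit_ip G (row i Z) x = ip (row i Z) (act g x) ->
  ip (row i Z) (act h x) < ip (row i Z) (act g x).
Proof.
move=> GG sx gG hG hg gE.
by rewrite lt_neqAle sx //= -gE orbit_ip_ge.
Qed.

(** Moving [g^T] across the inner product reduces the cell inequality to strict maximality of [h].
    As [g] is arbitrary, one translate of a template can be placed in cells belonging to two
    different orbits. *)
Lemma in_voronoi_maximizer {R : realType} {n d : nat} (G : seq 'M[R]_d)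
    (Z : 'M[R]_(n, d)) (x : 'rV[R]_d) (i : 'I_n) (g h : 'M[R]_d) :
  finite_subgroup_O G -> separated G Z x -> g \in G -> h \in G ->
  orbit_ip G (row i Z) x = ip (row i Z) (act h x) ->
  in_voronoi G (act (g^T *m h) x) (act g^T (row i Z)).
Proof.
move=> GG sx gG hG hE; have [_ GM GO] := GG.
move=> _ /mapP[k kG ->]; rewrite act_mul => kx.
rewrite [ltLHS]ipC [ltRHS]ipC -!ip_act !act_mul !mulmxA (GO _ gG) mul1mx.
apply: (@separated_maximizer _ _ _ G) => //.
  by rewrite !GM // trmx_in_group.
(* If the two group elements agreed, [k] would fix the centre of the cell, which [kx] excludes. *)
apply: contraNneq kx => kE; rewrite -[in X in _ == X]kE !mulmxA.
by rewrite mulTmx_orthogonal ?mul1mx //; apply: GO.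
Qed.

(** Whether two cells meet is an existential over vectors, so the orbit is filtered by a classical
    Boolean. The bound in [voronoi_char] applies to such an enumeration. *)
Lemma card_S_exists {R : realType} {d : nat} (G : seq 'M[R]_d)
    (x y : 'rV[R]_d) :
  exists2 s : seq 'rV[R]_d, uniq s & forall q, q \in s <->
    (q \in Defs.orbit G y /\ exists w, in_voronoi G q w /\ in_voronoi G x w).
Proof.
pose V q := boolp.asbool (exists w, in_voronoi G q w /\ in_voronoi G x w).
exists (undup (filter V (Defs.orbit G y))) => [|q]; first exact: undup_uniq.
rewrite mem_undup mem_filter; split.
  by move=> /andP[/boolp.asboolP ? ?].
by move=> [-> ?]; rewrite andbT; apply/boolp.asboolP.
Qed.

Lemma sum_injective_le {R : realType} {n d : nat} (f : 'I_d -> 'I_n)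
    (F : 'I_n -> R) :
  injective f -> (forall i, 0 <= F i) -> \sum_j F (f j) <= \sum_i F i.
Proof.
move=> injf F0.
rewrite [leRHS](bigID (mem (f @: setT))) /= [X in X + _]big_imset /=; last first.
  by move=> j k _ _; apply: injf.
rewrite (_ : \sum_(j in setT) F (f j) = \sum_j F (f j)); last first.
  by apply: eq_bigl => j; rewrite inE.
by rewrite lerDl sumr_ge0.
Qed.

(* The translates w i of the templates see x against the point q i of the orbit
   of y.  These points all lie in S(x, y), so d of them coincide. *)
Lemma max_filter_lower_separated {R : realType} {n d : nat} (G : seq 'M[R]_d)
    (chi : nat) (Z : 'M[R]_(n, d)) (a : R) (x y : 'rV[R]_d) :
  finite_subgroup_O G -> voronoi_char G chi -> (chi * (d - 1) < n)%N -> 0 <= a ->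
  (forall (f : {ffun 'I_d -> 'I_n}) (c : {ffun 'I_d -> seq_sub G}), injective f ->
     forall u, a * enorm u <= enorm (u *m (template_mx G f c Z)^T)) ->
  separated G Z x -> separated G Z y ->
  a * orbit_dist G x y <= enorm (max_filter G Z x - max_filter G Z y).
Proof.
move=> GG [_ chi_max] chin a0 aP sx sy; have [G1 GM GO] := GG.
have n0 : (0 < n)%N by apply: leq_ltn_trans chin.
have [g gG gE] := fin_all_exists2 (fun i => orbit_ip_attained _ (row i Z) x GG).
have [h hG hE] := fin_all_exists2 (fun i => orbit_ip_attained _ (row i Z) y GG).
have gTG i : (g i)^T \in G by apply: trmx_in_group.
pose w i := act (g i)^T (row i Z); pose q i := act ((g i)^T *m h i) y.
have [s us sP] := card_S_exists G x y.
have qs i : q i \in s.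
  apply/sP; split; first by apply/mapP; exists ((g i)^T *m h i); rewrite ?GM.
  exists (w i); split; first exact: in_voronoi_maximizer.
  (* Taking both group elements equal to [g i] gives the cell of [x] itself. *)
  have := in_voronoi_maximizer _ _ _ _ _ _ GG sx (gG i) (gG i) (gE i).
  by rewrite mulTmx_orthogonal ?act1 //; apply: GO.
have schi : (size s <= chi)%N.
  by apply: (chi_max x y); [exact: separated_principal sx|
    exact: separated_principal sy|exists s].
have [|q0 q0s [f injf fq]] := @pigeonhole_fiber _ n d q s qs.
  by apply: leq_ltn_trans chin; rewrite leq_mul2r schi orbT.
have diffE i : (max_filter G Z x - max_filter G Z y) 0 i = ip (w i) (x - q i).
  rewrite !mxE gE hE ipBr -[ip (w i) x]ip_act /q -act_mul -[ip (w i) (act _ _)]ip_act.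
  by rewrite act_mul (GO _ (gG i)) act1.
have [/mapP[k kG q0E] _] := (sP q0).1 q0s.
apply: (@le_trans _ _ (a * enorm (x - q0))).
  by rewrite ler_wpM2l // q0E orbit_dist_le.
(* With these transposes, row [j] of the template matrix is [w (f j)]. *)
pose c : {ffun 'I_d -> seq_sub G} := [ffun j => SeqSub (gTG (f j))].
apply: le_trans (aP f c injf (x - q0)) _.
rewrite -(@ler_pXn2r _ 2) ?nnegrE ?enorm_ge0 // !enorm_sqr.
rewrite [leRHS](_ : _ = \sum_i ip (w i) (x - q i) ^+ 2); last first.
  by apply: eq_bigr => i _; rewrite diffE expr2.
(* Only the coordinates selected by [f] are kept; there [q] has the common value [q0]. *)
apply: le_trans (sum_injective_le f _ injf _); last by move=> i; apply: sqr_ge0.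
apply: ler_sum => j _; rewrite -expr2 fq.
rewrite (_ : (_ *m _) 0 j = ip (w (f j)) (x - q0)) //.
rewrite ipC mxE; apply: eq_bigr => l _.
by rewrite [_^T l j]mxE [template_mx _ _ _ _ j l]mxE ffunE.
Qed.

Lemma max_filter_lower {R : realType} {n d : nat} (G : seq 'M[R]_d)
    (chi : nat) (Z : 'M[R]_(n, d)) (a : R) (x y : 'rV[R]_d) :
  finite_subgroup_O G -> voronoi_char G chi -> (chi * (d - 1) < n)%N -> 0 <= a ->
  (forall (f : {ffun 'I_d -> 'I_n}) (c : {ffun 'I_d -> seq_sub G}), injective f ->
     forall u, a * enorm u <= enorm (u *m (template_mx G f c Z)^T)) ->
  (forall i, principal G (row i Z)) ->
  a * orbit_dist G x y <= enorm (max_filter G Z x - max_filter G Z y).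
Proof.
move=> GG vc chin a0 aP prZ; apply/ler_addgt0Pr => e e0.
have [b b0 bP] := max_filter_Lipschitz G Z GG.
have ab0 : 0 < 2 * (a + b) by lra.
(* Moving each point by at most this [t] costs at most [2 * a * t] on the left and [2 * b * t] on
   the right, [e] in total. *)
have t0 : 0 < e / (2 * (a + b)) by rewrite divr_gt0.
have [x' xx' sx] := separated_dense _ _ x _ GG prZ t0.
have [y' yy' sy] := separated_dense _ _ y _ GG prZ t0.
have low := max_filter_lower_separated _ _ _ _ _ _ GG vc chin a0 aP sx sy.
have dle := orbit_dist_triangle _ x y x' y' GG.
have adle := ler_wpM2l a0 dle.
have Pxx := bP x' x; have Pyy := bP y y'.
have Ple : enorm (max_filter G Z x' - max_filter G Z y') <=
    enorm (max_filter G Z x' - max_filter G Z x) +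
    enorm (max_filter G Z x - max_filter G Z y) +
    enorm (max_filter G Z y - max_filter G Z y').
  rewrite -[max_filter G Z x' - _](subrKA (max_filter G Z x)).
  rewrite -[max_filter G Z x - max_filter G Z y'](subrKA (max_filter G Z y)).
  by rewrite addrA; apply: le_trans (enormD _ _) _; rewrite lerD2r enormD.
have tE : e / (2 * (a + b)) * (2 * (a + b)) = e by rewrite divfK // gt_eqF.
rewrite (enormB x' x) in Pxx.
move: tE xx' yy'; set t := e / _ => tE xx' yy'.
have := ler_wpM2l a0 xx'; have := ler_wpM2l a0 yy'.
have := ler_wpM2l (ltW b0) xx'; have := ler_wpM2l (ltW b0) yy'.
rewrite !mulrDr in tE adle *.
by lra.
Qed.

(* Generic: outside the zero set of some nonzero polynomial in the n*d
   coordinates of (z_1,...,z_n) (the rows of Z, flattened by mxvec). *)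
Theorem theorem31 (R : realType) (d n : nat) (G : seq 'M[R]_d) (chi : nat) :
  finite_subgroup_O G ->
  voronoi_char G chi ->
  (chi * (d - 1) < n)%N ->
  exists p : {mpoly R[n * d]}, p != 0 /\
    forall Z : 'M[R]_(n, d),
      p.@[fun k => mxvec Z 0 k] != 0 -> bilipschitz_mf G Z.
Proof.
move=> GG vc chin.
have [p [p0 pP]] := @generic_principal R n d G.
have [q [q0 qP]] := @generic_template_mx R n d G GG.
exists (p * q); split; first by rewrite mulf_neq0.
move=> Z; rewrite mevalM mulf_eq0 negb_or => /andP[/pP prZ /qP detZ].
have [|[f c]|a a0 aP] := @exists_uniform_constant R
    ({ffun 'I_d -> 'I_n} * {ffun 'I_d -> seq_sub G})%type
    (fun fc a => injective fc.1 -> forall u : 'rV[R]_d,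
       a * enorm u <= enorm (u *m (template_mx G fc.1 fc.2 Z)^T)).
- move=> fc a b _ ba H injf u; apply: le_trans (H injf u).
  by rewrite ler_wpM2r ?enorm_ge0.
- have [/injectiveP injf|ninjf] := boolP (injectiveb f); last first.
    by exists 1 => // /injectiveP; rewrite (negbTE ninjf).
  have [|a a0 aP] := @enorm_unitmx_lower R d (template_mx G f c Z)^T.
    by rewrite unitmx_tr unitmxE unitfE detZ.
  by exists a.
have [b b0 bP] := max_filter_Lipschitz G Z GG.
(* The maximum secures [a <= b] and still bounds from above. *)
exists a, (Num.max a b); split=> [||x y]; rewrite ?le_max ?lexx //; split.
  apply: max_filter_lower vc chin _ _ _ => //; first exact: ltW.
  by move=> f c; apply: (aP (f, c)).
(* Replacing [y] by its orbit point nearest to [x] leaves the filter unchanged and makes the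
   Euclidean distance the orbit distance. *)
have [h hG ->] := orbit_dist_attained _ x y GG.
rewrite -(max_filter_act _ _ y _ GG hG); apply: le_trans (bP _ _) _.
by rewrite ler_wpM2r ?enorm_ge0 // le_max lexx orbT.
Qed.
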